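(* Let $c_*:=\sqrt{\log 2}$ and for $0<\delta<1$ let \[ I(\delta):=\tfrac12\big((1-\delta)\log(1-\delta)+(1+\delta)\log(1+\delta)\big). \] Fix constants $0<c<c_p<c_*$ and choose $\delta\in(0,1)$ with $c_p^2<I(\delta)$. Define $K(m):=\lfloor \exp(c\sqrt{\log m})\rfloor$ and $P(m):=\lfloor \exp(c_p\sqrt{\log m})\rfloor$. Let $S$ be the set of $m\in\mathbb{N}$ such that for all integers $k$ with $0\le k\le K(m)$ and all primes $p$, \[ \nu_p\!\left(\binom{2m}{m}\right)-\nu_p\!\left(\binom{m+k}{m}\right)\ \ge\ \frac{1-\delta}{2}\,\frac{\log m}{\log p}\cdot[\,p\le P(m)\,]. \] Then $S$ has asymptotic density $1$.
   Context: $\nu_p$ denotes the $p$-adic valuation; $[\,p\le P(m)\,]$ is the Iverson bracket (equal to $1$ if $p\le P(m)$, else $0$); $\log$ is the natural logarithm. *)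

(* Defs.v *)
From mathcomp Require Import all_boot all_order all_algebra.
From mathcomp Require Import all_classical all_reals all_analysis.

Set Implicit Arguments.
Unset Strict Implicit.
Unset Printing Implicit Defensive.

Import Order.TTheory GRing.Theory Num.Theory.
Import numFieldNormedType.Exports.

Local Open Scope classical_set_scope.
Local Open Scope ring_scope.

Definition asymptotic_density (R : realType) (A : set nat) (d : R) : Prop :=
  (fun n : nat => (\sum_(1 <= m < n.+1 | m \in A) 1) / n%:R : R) @ \oo --> d.

Definition cstar (R : realType) : R := Num.sqrt (ln 2).

Definition rateI (R : realType) (delta : R) : R :=
  2^-1 * ((1 - delta) * ln (1 - delta) + (1 + delta) * ln (1 + delta)).

(* [Num.truncn] is the nat-valued floor of a nonnegative real. *)
Definition floor_exp_sqrt_log (R : realType) (a : R) (m : nat) : nat :=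
  Num.truncn (expR (a * Num.sqrt (ln m%:R))).

(* [logn p] is the p-adic valuation; the condition [0 < m] only discards the
   index 0, at which log m is undefined. The difference of valuations is taken
   in [R], since [nat] subtraction truncates. *)
Definition good_set (R : realType) (c cp delta : R) : set nat :=
  [set m : nat | (0 < m)%N /\
    forall k p : nat, (k <= floor_exp_sqrt_log c m)%N -> prime p ->
      (logn p 'C(2 * m, m))%:R - (logn p 'C(m + k, m))%:R >=
      (1 - delta) / 2 * (ln m%:R / ln p%:R)
        * (p <= floor_exp_sqrt_log cp m)%N%:R :> R].

(* Main.v *)
(* By Kummer's theorem both valuations count carries. If [2 k <= p], every carry
   in [m + k] sits at a position where [m + m] also carries, so primes
   [p > P(m) >= 2 K(m) - 1] are harmless for every large [m]. For [p <= P(m)],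
   [m + k] carries at most [eps * log m / log p] times unless the low digits of
   [m] lie just below a power of [p], which a union bound excludes; and [m + m]
   carries about [log m / (2 log p)] times, with fewer than
   [(1 - delta + 4 eps) log m / (2 log p)] carries having probability at most
   [exp (- rho log m / log p)] by Chernoff's bound, where [rho] is close to
   [I(delta)]. Summing over [p <= exp (cp sqrt (log m))] leaves
   [exp ((cp - rho / cp) sqrt (log m))], which tends to 0 since [cp ^ 2 < rho].
   For small [p] a digit is at least [p / 2] with probability noticeably smaller
   than 1/2, so there one works in base [p ^ L] with a large constant [L], once
   for each of the [L] offsets of the blocks. *)

Require Import Defs.
From mathcomp Require Import all_boot all_order all_algebra.
From mathcomp Require Import all_classical all_reals all_analysis.
From mathcomp Require Import zify ring lra.

Import Order.TTheory GRing.Theory Num.Theory.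

(** * Valuations of binomial coefficients as carry counts *)

Lemma logn_fact_widen p n T : prime p -> n < T ->
  logn p n`! = \sum_(1 <= i < T) n %/ p ^ i.
Proof.
move=> pp nT; rewrite logn_fact // [RHS](big_cat_nat (n := n.+1)) //=.
rewrite [X in _ = _ + X]big_nat [X in _ = _ + X]big1 ?addn0 // => i /andP[ni _].
by rewrite divn_small // (leq_trans ni) // ltnW // ltn_expl // prime_gt1.
Qed.

(** Legendre's formula: at index [i] the quotient of [m + k] exceeds the sum of the quotients of [m]
    and [k] by the carry. The free bound [T] lets two such sums be compared term by term. *)
Lemma logn_bin_carries p m k T : prime p -> m + k < T ->
  logn p 'C(m + k, m) = \sum_(1 <= i < T) (p ^ i <= m %% p ^ i + k %% p ^ i).
Proof.
move=> pp mkT.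
have /(congr1 (logn p)) := bin_fact (leq_addr k m).
rewrite addKn !lognM ?muln_gt0 ?fact_gt0 ?bin_gt0 ?leq_addr //.
rewrite !(logn_fact_widen _ _ T) //; try lia.
under [X in _ = X -> _]eq_bigr => i _ do
  rewrite divnD ?expn_gt0 ?prime_gt0 // addnC.
by rewrite !big_split /=; lia.
Qed.

(** A carry of [m + k] at index [i] forces [m %% p ^ i] to be at least [p ^ i - k], hence at least
    half of [p ^ i]. *)
Lemma logn_bin_le_central p m k : prime p -> 2 * k <= p ->
  logn p 'C(m + k, m) <= logn p 'C(2 * m, m).
Proof.
move=> pp kp; rewrite mul2n -addnn.
rewrite !(logn_bin_carries _ _ _ (m + m + k).+1) //; try lia.
rewrite big_nat [leqRHS]big_nat; apply: leq_sum => i /andP[i1 _].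
have pi : p <= p ^ i by rewrite -{1}(expn1 p) leq_exp2l // prime_gt1.
have := leq_mod k (p ^ i); lia.
Qed.

(** Adding [k] leaves the quotient by [p ^ b] unchanged, so nothing carries at indices above [b]. *)
Lemma logn_bin_le_of_no_carry p m k b : prime p -> k + m %% p ^ b < p ^ b ->
  logn p 'C(m + k, m) <= b.
Proof.
move=> pp kb; have pgt0 j : 0 < p ^ j by rewrite expn_gt0 prime_gt0.
rewrite (logn_bin_carries _ _ _ (m + k + b).+1) //; last lia.
rewrite (big_cat_nat (n := b.+1)) //=; last lia.
rewrite [X in _ + X]big_nat [X in _ + X]big1 ?addn0; last first.
  move=> i /andP[bi _].
  have E : (m + k) %/ p ^ i = m %/ p ^ i.
    rewrite -(subnKC (ltnW bi)) expnD !divnMA; congr (_ %/ _).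
    rewrite divnD // (divn_small (m := k)) ?(modn_small (m := k)); lia.
  have := divnD m k (pgt0 i); rewrite E; case: (_ <= _ + _)%N; lia.
apply: leq_trans (_ : \sum_(1 <= i < b.+1) 1 <= _).
  by apply: leq_sum => i _; apply: leq_b1.
by rewrite sum_nat_const_nat subn1 muln1.
Qed.

(** * Digit blocks that force carries *)

(* Cut the base-[p] digits of [m], from position [r] on, into blocks of length
   [L]: this counts the first [n] blocks that are at least half of [p ^ L]. Such
   a block forces a carry out of its top position in [m + m], whatever the lower
   digits are; unlike the carries themselves, blocks are independent. *)
Definition block_count (p r L n m : nat) : nat :=
  \sum_(0 <= j < n) (p ^ L <= 2 * ((m %/ p ^ (r + j * L)) %% p ^ L)).

Lemma carry_of_top_block p a L m :
  p ^ L <= 2 * ((m %/ p ^ a) %% p ^ L) ->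
  p ^ (a + L) <= 2 * (m %% p ^ (a + L)).
Proof.
rewrite modn_divl expnD [p ^ a * _]mulnC => h.
rewrite (leq_trans (leq_mul h (leqnn (p ^ a)))) // -mulnA leq_mul2l.
by rewrite leq_divM.
Qed.

Lemma sum_nat_shift (R : nmodType) (k i : nat) (F : nat -> R) :
  (\sum_(i * k <= j < i.+1 * k) F j = \sum_(0 <= j < k) F (j + i * k)%N)%R.
Proof. by rewrite -{1}(add0n (i * k)) big_addn mulSn addnK. Qed.

(** Block [j] at offset [r] yields the carry of index [L + r + j * L]; for [r < L] these indices are
    distinct, so no carry is counted twice. *)
Lemma sum_block_count_le p L n m : prime p -> 0 < L ->
  \sum_(0 <= r < L) block_count p r L n m <= logn p 'C(2 * m, m).
Proof.
move=> pp L0; rewrite mul2n -addnn.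
rewrite (logn_bin_carries _ _ _ (m + m + 1 + (L + n * L))) //; last lia.
pose F i := nat_of_bool (p ^ i <= m %% p ^ i + m %% p ^ i).
rewrite (leq_trans (n := \sum_(L <= i < L + n * L) F i)) //; last first.
  rewrite [leqRHS](big_cat_nat (n := L)) //=; last lia.
  rewrite [X in _ <= _ + X](big_cat_nat (n := L + n * L)) //=; last first.
  - lia.
  - lia.
  - by rewrite addnCA leq_addr.
have := @big_addn _ 0 addn 0 (L + n * L) L xpredT F.
rewrite add0n addKn => ->; rewrite big_nat_mul.
rewrite [leqLHS]exchange_big /= leq_sum // => j _.
rewrite sum_nat_shift leq_sum // => r _; rewrite /F.
case E: (p ^ L <= 2 * _) => //.
by have := carry_of_top_block _ _ _ _ E; rewrite mul2n -addnn => ->.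
Qed.

(** * Counting by residues and Chernoff's bound *)

Lemma sum_periodic_le N q (B : nat -> nat) : 0 < q ->
  (forall m, B m = B (m %% q)) ->
  \sum_(0 <= m < N.+1) B m <= (N %/ q).+1 * \sum_(0 <= m < q) B m.
Proof.
move=> q0 Bq; rewrite (leq_trans (n := \sum_(0 <= m < (N %/ q).+1 * q) B m)) //.
  by rewrite [leqRHS](big_cat_nat (n := N.+1)) ?leq_addr //= ltn_ceil.
rewrite big_nat_mul -[leqLHS]/(\sum_(0 <= i < (N %/ q).+1) _).
rewrite (eq_bigr (fun=> \sum_(0 <= m < q) B m)); last first.
  move=> i _; rewrite sum_nat_shift; apply: eq_big_nat => j /andP[_ jq].
  by rewrite Bq addnC modnMDl modn_small.
by rewrite sum_nat_const_nat subn0.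
Qed.

Lemma block_count_mod p r L n m :
  block_count p r L n m = block_count p r L n (m %% p ^ (r + n * L)).
Proof.
rewrite /block_count; apply: eq_big_nat => j /andP[_ jn].
rewrite !modn_divl modn_dvdm // -expnD dvdn_exp2l //; nia.
Qed.

Local Open Scope ring_scope.

(** Independence of the blocks as a product formula: the top block splits off while the lower digits
    run freely. The factor [p ^ r] counts the digits below the first block. *)
Lemma sum_exp_block_count (R : comNzRingType) (lam : R) p r L n : (0 < p)%N ->
  \sum_(0 <= m < p ^ (r + n * L)) lam ^+ block_count p r L n m =
  (p ^ r)%:R * (\sum_(0 <= d < p ^ L) lam ^+ (p ^ L <= 2 * d)%N) ^+ n.
Proof.
move=> p0; elim: n => [|n IH].
  rewrite addn0 mulr1 (eq_bigr (fun=> 1)) ?sumr_const_nat ?subn0 //.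
  by move=> m _; rewrite /block_count big_geq.
rewrite mulSn addnCA expnD big_nat_mul exprS mulrCA -IH.
rewrite mulr_suml; apply: eq_big_nat => d /andP[_ dL].
rewrite sum_nat_shift mulr_sumr; apply: eq_big_nat => m /andP[_ mA].
rewrite -exprD /block_count big_nat_recr //=.
rewrite -!/(block_count _ _ _ _ _).
rewrite block_count_mod (addnC m) modnMDl modn_small // divnMDl ?expn_gt0 ?p0 //.
by rewrite divn_small // addn0 modn_small // addnC.
Qed.

(** For odd [q] the digits below half outnumber the others by one; this costs at most 1/2, which
    [eps * q] absorbs. *)
Lemma sum_exp_digit_le (R : realFieldType) (lam eps : R) q :
  lam <= 1 -> 0 <= lam -> 1 <= 2 * eps * q%:R ->
  \sum_(0 <= d < q) lam ^+ (q <= 2 * d)%N <= q%:R * ((1 + lam) / 2 + eps).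
Proof.
move=> lam1 lam0 epsq; have hq : (uphalf q <= q)%N by lia.
rewrite (big_cat_nat (n := uphalf q)) //=.
rewrite (eq_big_nat _ _ (F2 := fun=> 1)); last first.
  by move=> d /andP[_ dq]; have -> : (q <= 2 * d)%N = false by lia.
rewrite [X in _ + X](eq_big_nat _ _ (F2 := fun=> lam)); last first.
  by move=> d /andP[dq _]; have -> : (q <= 2 * d)%N = true by lia.
rewrite !sumr_const_nat subn0 -[_ *+ (q - _)]mulr_natr natrB //.
have hh : 2 * (uphalf q)%:R <= q%:R + 1 :> R by rewrite -natrM natr1 ler_nat; lia.
by set h := (uphalf q)%:R in hh *; nra.
Qed.

(** Exponential Markov inequality over one period [p ^ (r + n * L)]. As the period is at most [N],
    rounding up to whole periods costs at most the factor 2. *)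
Lemma chernoff_block_count (R : realType) (lam eps t rho : R) p r L n N :
  (0 < p)%N -> 0 < lam -> lam <= 1 -> 1 <= 2 * eps * (p ^ L)%:R ->
  (1 + lam) / 2 + eps <= expR (t * ln lam - rho) ->
  (p ^ (r + n * L) <= N)%N ->
  (\sum_(0 <= m < N.+1) ((block_count p r L n m)%:R <= t * n%:R)%R)%N%:R
    <= 2 * N%:R * expR (- rho * n%:R).
Proof.
move=> p0 lam0 lam1 epsL hrho AN.
set A := (p ^ (r + n * L))%N in AN *.
have A0 : (0 < A)%N by rewrite expn_gt0 p0.
pose B m : nat := ((block_count p r L n m)%:R <= t * n%:R)%R.
have per m : B m = B (m %% A)%N by rewrite /B block_count_mod.
have := sum_periodic_le N A B A0 per; rewrite -/(B _) -(ler_nat R).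
move/le_trans; apply; rewrite natrM.
have tail : (\sum_(0 <= m < A) B m)%N%:R <= A%:R * expR (- rho * n%:R).
  (* Scale by [lam] to the power [t * n]; since [lam <= 1], this is at most
     [lam ^+ block_count p r L n m] wherever the event holds. *)
  have e0 := expR_gt0 (t * n%:R * ln lam).
  rewrite -(ler_pM2l e0) natr_sum mulr_sumr.
  apply: (@le_trans _ _ (\sum_(0 <= m < A) lam ^+ block_count p r L n m)).
    apply: ler_sum => m _; rewrite /B.
    case h: (_ <= t * n%:R); last by rewrite mulr0 exprn_ge0 // ltW.
    rewrite mulr1 -{2}(lnK (x := lam)) // -expRM_natl ler_expR.
    by rewrite ler_wnM2r // ln_le0.
  have -> : expR (t * n%:R * ln lam) * (A%:R * expR (- rho * n%:R)) =
      (p ^ r)%:R * ((p ^ L)%:R ^+ n * expR (n%:R * (t * ln lam - rho))).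
    rewrite /A expnD natrM mulnC expnM (natrX _ (p ^ L)) mulrCA -expRD.
    by rewrite -[LHS]mulrA; congr (_ * (_ * expR _)); ring.
  rewrite sum_exp_block_count // ler_wpM2l //.
  rewrite expRM_natl -exprMn lerXn2r ?nnegrE //.
  - by apply: sumr_ge0 => i _; rewrite exprn_ge0 // ltW.
  - apply: le_trans (sum_exp_digit_le _ _ _ _ lam1 (ltW lam0) epsL) _.
    by rewrite ler_wpM2l.
apply: le_trans (ler_wpM2l _ tail) _ => //.
rewrite mulrA ler_wpM2r ?expR_ge0 // -!natrM ler_nat.
have := leq_divM N A; have : (1 <= N %/ A)%N by rewrite divn_gt0.
nia.
Qed.

(** Only the top [K] residues modulo [q] qualify, and at most [2 * N / q] periods cover the
    range. *)
Lemma count_near_top_le N q K : (0 < q <= N)%N ->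
  (q * \sum_(0 <= m < N.+1) (q <= K + m %% q)%N <= 2 * N * K)%N.
Proof.
move=> /andP[q0 qN].
have per m : nat_of_bool (q <= K + m %% q)%N = (q <= K + (m %% q) %% q)%N.
  by rewrite modn_mod.
have := sum_periodic_le N q _ q0 per.
have : (\sum_(0 <= m < q) (q <= K + m %% q)%N <= K)%N.
  rewrite (big_cat_nat (n := (q - K)%N)) //=; last by lia.
  rewrite big_nat big1 => [|m /andP[_ h]]; last first.
    rewrite modn_small; last by lia.
    by apply/eqP; rewrite eqb0 -ltnNge; lia.
  rewrite add0n; apply: leq_trans (_ : \sum_(q - K <= m < q) 1 <= _)%N.
    by apply: leq_sum => i _; apply: leq_b1.
  by rewrite sum_nat_const_nat muln1; lia.
have := leq_divM N q; have : (1 <= N %/ q)%N by rewrite divn_gt0.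
set S := (\sum_(0 <= m < q) _)%N; set T := (\sum_(0 <= m < N.+1) _)%N.
set d := (N %/ q)%N => d1 dq SK TS.
have : (q * T <= q * (d.+1 * K))%N by nia.
nia.
Qed.

(** * Growth estimates and choice of constants *)

Lemma sqrt_ln_ge (R : realType) (M : R) :
  exists N0 : nat, forall n, (N0 <= n)%N -> M <= Num.sqrt (ln n%:R).
Proof.
exists (Num.truncn (expR (M ^+ 2))).+1 => n hn.
have h : M ^+ 2 <= ln n%:R.
  have nM : expR (M ^+ 2) <= n%:R.
    by apply: le_trans (ltW (truncnS_gt _)) _; rewrite ler_nat.
  rewrite -[leLHS]expRK ler_ln // ?posrE ?expR_gt0 //.
  exact: lt_le_trans (expR_gt0 _) nM.
apply: le_trans (ler_norm M) _.
by rewrite -sqrtr_sqr ler_sqrt // (le_trans (sqr_ge0 M)).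
Qed.

Lemma expRN_le (R : realType) (e : R) : 0 < e ->
  exists Y : R, forall y, Y <= y -> expR (- y) <= e.
Proof.
move=> e0; exists (- ln e) => y hy.
by rewrite -[leRHS]lnK ?posrE // ler_expR lerNl.
Qed.

Lemma exists_slack (R : realType) (cp delta : R) :
  0 < delta -> delta < 1 -> cp ^+ 2 < rateI delta ->
  exists lam eps rho : R, [/\ 0 < lam <= 1, 0 < eps <= 1, cp ^+ 2 < rho &
    (1 + lam) / 2 + eps <= expR (((1 - delta) / 2 + 2 * eps) * ln lam - rho)].
Proof.
move=> d0 d1 hI.
have p1 : 0 < 1 - delta by lra.
have p2 : 0 < 1 + delta by lra.
(* The optimal Chernoff parameter: with [eps = 0] and [rho = rateI delta] both sides equal
   [(1 + delta)^-1]. *)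
pose lam := (1 - delta) / (1 + delta).
have lam0 : 0 < lam by rewrite divr_gt0.
have lam1 : lam <= 1 by rewrite ler_pdivrMr // mul1r; lra.
have lnlam : ln lam = ln (1 - delta) - ln (1 + delta).
  by rewrite lnM ?lnV ?posrE ?invr_gt0.
have lnlam0 : ln lam <= 0 by rewrite ln_le0.
pose rho := (cp ^+ 2 + rateI delta) / 2.
(* The added [eps] on the left costs at most [2 * eps] in the exponent, the shift of the threshold
   costs [- 2 * eps * ln lam]; together they must fit in the gap between [rho] and [rateI delta]. *)
pose eps := Num.min 1 ((rateI delta - rho) / (2 * (1 - ln lam))).
have gap : 0 < rateI delta - rho by rewrite /rho; lra.
have den : 0 < 2 * (1 - ln lam) by lra.
have eps0 : 0 < eps by rewrite lt_min ltr01 divr_gt0.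
have eps1 : eps <= 1 by rewrite ge_min lexx.
have epsg : eps * (2 * (1 - ln lam)) <= rateI delta - rho.
  by rewrite -ler_pdivlMr // ge_min lexx orbT.
exists lam, eps, rho; split; rewrite ?lam0 ?eps0 //; first by rewrite /rho; lra.
have a : (1 + lam) / 2 = (1 + delta)^-1 by rewrite /lam; field; lra.
have ae : (1 + delta)^-1 = expR (- ln (1 + delta)) by rewrite expRN lnK ?posrE.
apply: (@le_trans _ _ (expR (- ln (1 + delta)) * expR (2 * eps))).
  rewrite a -ae; have := expR_ge1Dx (2 * eps) => h.
  apply: (@le_trans _ _ ((1 + delta)^-1 * (1 + 2 * eps))); last first.
    by rewrite ler_wpM2l // invr_ge0 ltW.
  have : 2^-1 <= (1 + delta)^-1 by rewrite lef_pV2 ?posrE //; lra.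
  nra.
rewrite -expRD ler_expR; move: epsg; rewrite /rateI lnlam; nra.
Qed.

(** * Exceptional sets for a single prime *)

Definition block_len (Q p : nat) : nat := if (p < Q)%N then Q else 1.

(** The predecessor leaves room for any offset below the block length, so that the period of the
    block count stays at most [N]. *)
Definition block_num (Q N p : nat) : nat :=
  (trunc_log p N %/ block_len Q p).-1.

Definition low_len {R : realType} (eps : R) (N p : nat) : nat :=
  Num.truncn (eps * (ln N%:R / ln p%:R)).

Definition few_carries {R : realType} (t : R) (Q N p m : nat) : nat :=
  \sum_(0 <= r < block_len Q p)
    ((block_count p r (block_len Q p) (block_num Q N p) m)%:R
       <= t * (block_num Q N p)%:R)%R.

(* Indicator of the event that some [k <= K] produces a carry out of the lowest
   [low_len eps N p] digits of [m + k]. *)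
Definition long_run {R : realType} (eps : R) (K N p m : nat) : nat :=
  (p ^ low_len eps N p <= K + m %% p ^ low_len eps N p)%N.

Lemma ln_prime_gt0 (R : realType) p : prime p -> 0 < ln p%:R :> R.
Proof. by move=> /prime_gt1 p1; rewrite ln_gt0 // ltr1n. Qed.

Lemma lt_trunc_logS (R : realType) (N p : nat) : prime p -> (0 < N)%N ->
  ln N%:R / ln p%:R < (trunc_log p N).+1%:R :> R.
Proof.
move=> pp N0; rewrite ltr_pdivrMr ?ln_prime_gt0 // mulr_natl -lnXn; last first.
  by rewrite ltr0n prime_gt0.
rewrite -natrX ltr_ln ?posrE ?ltr_nat ?ltr0n // ?expn_gt0 ?prime_gt0 //.
exact: trunc_log_ltn (prime_gt1 pp).
Qed.

Lemma block_len_gt0 Q p : (0 < block_len Q p)%N.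
Proof. by rewrite /block_len; case: ifP => // /(leq_trans _); apply. Qed.

Lemma lt_block_len_num Q N p :
  (trunc_log p N < block_len Q p * (block_num Q N p + 2))%N.
Proof.
have L0 := block_len_gt0 Q p; rewrite /block_num.
have := ltn_ceil (trunc_log p N) L0; set n := (_ %/ _)%N; nia.
Qed.

Lemma le_block_num (R : realType) Q N p : prime p -> (0 < N)%N ->
  ln N%:R / ln p%:R <=
    (block_len Q p)%:R * ((block_num Q N p)%:R + 2) :> R.
Proof.
move=> pp N0; apply: le_trans (ltW (lt_trunc_logS R N p pp N0)) _.
by rewrite -natrD -natrM ler_nat lt_block_len_num.
Qed.

(* Primes below [Q] are compensated by longer blocks, so that the number of
   blocks is at least of order [sqrt (log N)] for every prime in range. *)
Lemma block_num_ge (R : realType) (cp X : R) Q N p : prime p -> (0 < N)%N ->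
  0 < cp -> 0 < X -> X ^+ 2 = ln N%:R -> ln p%:R <= cp * X ->
  Q%:R * ln Q%:R <= cp * X ->
  X / cp * (block_len Q p)%:R <= ln N%:R / ln p%:R.
Proof.
move=> pp N0 cp0 X0 hX hp hQ; have lp := ln_prime_gt0 R p pp.
rewrite ler_pdivlMr // -hX expr2 -!mulrA ler_pM2l // mulrC ler_pdivrMr //.
rewrite [X * _]mulrC /block_len; case: ltnP => pQ; last by rewrite mul1r.
apply: le_trans hQ; rewrite ler_wpM2l // ler_ln ?posrE ?ltr0n ?ler_nat //.
- exact: ltnW.
- exact: prime_gt0.
- exact: leq_trans pQ.
Qed.

Lemma few_carries_count_le (R : realType) (lam eps t rho cp X : R) Q N p :
  prime p -> (0 < N)%N -> 0 < cp -> 0 < X -> X ^+ 2 = ln N%:R ->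
  ln p%:R <= cp * X -> Q%:R * ln Q%:R <= cp * X -> 2 <= X / cp ->
  0 < lam -> lam <= 1 -> 0 < rho -> (0 < Q)%N -> 1 <= 2 * eps * Q%:R ->
  0 < eps ->
  (1 + lam) / 2 + eps <= expR (t * ln lam - rho) ->
  (\sum_(0 <= m < N.+1) few_carries t Q N p m)%N%:R
    <= Q%:R * (2 * N%:R * expR (- rho * (X / cp - 2))).
Proof.
move=> pp N0 cp0 X0 hX hp hQ X2 lam0 lam1 rho0 Q0 epsQ eps0 hrho.
have xL := block_num_ge R cp X Q N p pp N0 cp0 X0 hX hp hQ.
have xn := le_block_num R Q N p pp N0.
have L0 := block_len_gt0 Q p.
(* At least one whole block fits, so the predecessor in [block_num] is a genuine subtraction. *)
have Ln : (block_len Q p <= trunc_log p N)%N.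
  rewrite -ltnS -(ltr_nat R).
  apply: le_lt_trans (lt_trunc_logS R N p pp N0); apply: le_trans xL.
  by rewrite ler_peMl // (le_trans _ X2) // ler1n.
have nX : X / cp - 2 <= (block_num Q N p)%:R.
  have := le_trans xL xn; rewrite [leRHS]mulrC ler_pM2r ?ltr0n //; lra.
(* Long blocks for small primes and single digits for large ones both give a base of at least [Q],
   as the rounding error [eps] requires. *)
have pL : (Q <= p ^ block_len Q p)%N.
  rewrite /block_len; case: ltnP => // _.
  by rewrite ltnW // ltn_expl // prime_gt1.
rewrite [X in X%:R](_ : _ = \sum_(0 <= r < block_len Q p)
   \sum_(0 <= m < N.+1) ((block_count p r (block_len Q p) (block_num Q N p) m)%:R
       <= t * (block_num Q N p)%:R)%R)%N; last by rewrite exchange_big.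
rewrite natr_sum.
apply: (@le_trans _ _ (\sum_(0 <= r < block_len Q p)
    2 * N%:R * expR (- rho * (X / cp - 2)))); last first.
  rewrite sumr_const_nat subn0 -[_ *+ block_len _ _]mulr_natl ler_wpM2r ?mulr_ge0 ?expR_ge0 //.
  by rewrite ler_nat /block_len; case: ltnP.
rewrite big_nat [leRHS]big_nat; apply: ler_sum => r /andP[_ rL].
apply: le_trans (chernoff_block_count _ lam eps t rho _ _ _ _ _ _ _ _ _ _ _) _ => //.
- exact: prime_gt0.
- by apply: le_trans epsQ _; rewrite ler_pM2l ?mulr_gt0 // ler_nat.
- apply: leq_trans (trunc_logP (prime_gt1 pp) N0).
  rewrite leq_exp2l ?prime_gt1 // /block_num.
  have := leq_divM (trunc_log p N) (block_len Q p).
  have : (1 <= trunc_log p N %/ block_len Q p)%N by rewrite divn_gt0.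
  move: rL; set l := block_len Q p; set n := (_ %/ _)%N.
  move: (trunc_log p N) l n => T l n; clear; case: n => // n.
  by rewrite mulSn /=; lia.
- rewrite ler_wpM2l ?mulr_ge0 // ler_expR; nra.
Qed.

(** The modulus [p ^ low_len eps N p] exceeds [N] to the power [eps] divided by [p]; the factor [p]
    in the bound pays for the floor in [low_len]. *)
Lemma long_run_count_le (R : realType) (eps X : R) K N p :
  prime p -> (0 < N)%N -> 0 < eps <= 1 -> X ^+ 2 = ln N%:R ->
  (\sum_(0 <= m < N.+1) long_run eps K N p m)%N%:R
    <= 2 * N%:R * K%:R * p%:R * expR (- (eps * X ^+ 2)).
Proof.
move=> pp N0 /andP[eps0 eps1] hX.
have lp := ln_prime_gt0 R p pp; have p0 := prime_gt0 pp.
have lN : 0 <= ln N%:R :> R by rewrite ln_ge0 // ler1n.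
have x0 : 0 <= eps * (ln N%:R / ln p%:R) by rewrite mulr_ge0 ?divr_ge0 // ltW.
have /andP[b1 b2] := truncn_itv x0; rewrite -/(low_len eps N p) in b1 b2.
set b := low_len eps N p in b1 b2 *.
have pR : (0 : R) < p%:R by rewrite ltr0n.
have pE j : (p ^ j)%:R = expR (j%:R * ln p%:R) :> R.
  by rewrite expRM_natl lnK ?posrE // natrX.
have bN : (p ^ b <= N)%N.
  rewrite -(ler_nat R) pE -[leRHS]lnK ?posrE ?ltr0n // ler_expR.
  by rewrite -ler_pdivlMr // (le_trans b1) // ler_piMl // divr_ge0 // ltW.
have bX : expR (eps * X ^+ 2) <= p%:R * (p ^ b)%:R.
  rewrite -natrM -expnS pE ler_expR hX -ler_pdivrMr // -mulrA; exact: ltW.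
have b0 : (0 < p ^ b)%N by rewrite expn_gt0 p0.
have := count_near_top_le N (p ^ b) K; rewrite b0 bN => /(_ isT).
rewrite -(ler_nat R) -/(long_run _ _ _ _ _) !natrM.
set S := (\sum_(_ <= m < _) _)%N%:R => hS.
rewrite expRN ler_pdivlMr ?expR_gt0 //.
apply: (@le_trans _ _ (S * (p%:R * (p ^ b)%:R))); first by rewrite ler_wpM2l.
by rewrite mulrCA mulrC ler_wpM2r // mulrC.
Qed.

(** * Union bound over primes, with thresholds taken at [N] *)

Lemma le_floor_exp_sqrt_log (R : realType) (a : R) m N : 0 < a ->
  (0 < m <= N)%N ->
  (floor_exp_sqrt_log a m <= floor_exp_sqrt_log a N)%N.
Proof.
move=> a0 /andP[m0 mN]; apply: le_truncn.
have N1 : (0 < N)%N := leq_trans m0 mN.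
rewrite ler_expR ler_pM2l // ler_sqrt ?ln_ge0 ?ler1n //.
by rewrite ler_ln ?posrE ?ltr0n // ler_nat.
Qed.

Lemma floor_exp_sqrt_log_le (R : realType) (a : R) m :
  (floor_exp_sqrt_log a m)%:R <= expR (a * Num.sqrt (ln m%:R)).
Proof. by rewrite truncn_le expR_ge0. Qed.

(** Of the surplus [2 * eps] in the threshold, one [eps] pays for the carries of [m + k], the other
    for the two blocks per offset lost to rounding. *)
Lemma central_minus_shift_ge (R : realType) (delta eps : R) Q K N p k m :
  prime p -> (0 < N)%N -> 0 < eps -> delta < 1 -> (0 < Q)%N ->
  2 * Q%:R * ((1 - delta) / 2 + 2 * eps) <= eps * (ln N%:R / ln p%:R) ->
  few_carries ((1 - delta) / 2 + 2 * eps) Q N p m = 0%N ->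
  long_run eps K N p m = 0%N -> (k <= K)%N ->
  (1 - delta) / 2 * (ln N%:R / ln p%:R) <=
  (logn p 'C(2 * m, m))%:R - (logn p 'C(m + k, m))%:R.
Proof.
move=> pp N0 eps0 d1 Q0 hx hfew hlong kK.
set t := _ + 2 * eps in hx hfew; have t0 : 0 < t by rewrite /t; lra.
set x := ln N%:R / ln p%:R in hx *.
have lN : 0 <= ln N%:R :> R by rewrite ln_ge0 // ler1n.
have x0 : 0 <= x by rewrite divr_ge0 // ltW // ln_prime_gt0.
set L := block_len Q p; set n := block_num Q N p.
have L0 : (0 < L)%N := block_len_gt0 Q p.
have LQ : L%:R <= Q%:R :> R by rewrite ler_nat /L /block_len; case: ifP.
have lower : L%:R * (t * n%:R) <= (logn p 'C(2 * m, m))%:R.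
  have := sum_block_count_le p L n m pp L0; rewrite -(ler_nat R).
  apply: le_trans; rewrite natr_sum.
  apply: (@le_trans _ _ (\sum_(0 <= r < L) t * n%:R)).
    by rewrite sumr_const_nat subn0 mulr_natl.
  apply: ler_sum_nat => r rL.
  move/eqP: hfew; rewrite sum_nat_seq_eq0 => /allP /(_ r).
  by rewrite mem_index_iota rL implyTb eqb0 -ltNge => /(_ isT) /ltW.
have upper : (logn p 'C(m + k, m))%:R <= eps * x.
  have /andP[b1 _] := truncn_itv (mulr_ge0 (ltW eps0) x0).
  apply: le_trans b1; rewrite ler_nat.
  apply: logn_bin_le_of_no_carry => //; move/eqP: hlong.
  by rewrite eqb0 -ltnNge; apply: leq_trans; rewrite ltnS leq_add2r.
have xn := le_block_num R Q N p pp N0; rewrite -/x -/L -/n in xn.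
have : t * x <= L%:R * (t * n%:R) + 2 * Q%:R * t by nra.
move: lower upper hx; rewrite /t; lra.
Qed.

Definition bad_count {R : realType} (c cp t eps : R) (Q N m : nat) : nat :=
  \sum_(1 <= p < (floor_exp_sqrt_log cp N).+1 | prime p)
    (few_carries t Q N p m + long_run eps (floor_exp_sqrt_log c N) N p m).

Lemma prime_le_floor_exp (R : realType) (cp : R) N p : prime p ->
  (p <= floor_exp_sqrt_log cp N)%N ->
  ln p%:R <= cp * Num.sqrt (ln N%:R).
Proof.
move=> pp pP; have p0 := prime_gt0 pp.
rewrite -[leRHS]expRK ler_ln ?posrE ?expR_gt0 ?ltr0n //.
by apply: le_trans (floor_exp_sqrt_log_le _ _ _); rewrite ler_nat.
Qed.

(** The cutoffs at [N] dominate those at [m], and [ln m <= ln N] makes the bound required at [m] the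
    weaker one; so one count serves all [m <= N]. *)
Lemma good_of_bad_count0 (R : realType) (c cp delta eps : R) Q N m :
  let X := Num.sqrt (ln N%:R) in
  let t := (1 - delta) / 2 + 2 * eps in
  0 < c -> 0 < cp -> 0 < eps -> delta < 1 -> (0 < Q)%N -> (0 < m <= N)%N ->
  0 < X -> 2 * Q%:R * t <= eps * (X / cp) ->
  (2 * floor_exp_sqrt_log c m <= (floor_exp_sqrt_log cp m).+1)%N ->
  bad_count c cp t eps Q N m = 0%N -> good_set c cp delta m.
Proof.
move=> X t c0 cp0 eps0 d1 Q0 mN X0 hX hKP hbad.
have /andP[m0 mleN] := mN; have N0 := leq_trans m0 mleN.
split=> // k p kK pp.
case: (leqP p (floor_exp_sqrt_log cp m)) => pP /=; last first.
  rewrite mulr0 subr_ge0 ler_nat logn_bin_le_central //; lia.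
have pPN : (p <= floor_exp_sqrt_log cp N)%N.
  exact: leq_trans pP (le_floor_exp_sqrt_log _ _ _ _ cp0 mN).
have lp := ln_prime_gt0 R p pp.
have hp := prime_le_floor_exp R cp N p pp pPN.
have hXp : X / cp <= ln N%:R / ln p%:R.
  have sN : X ^+ 2 = ln N%:R by rewrite sqr_sqrtr // ln_ge0 // ler1n.
  by rewrite ler_pdivlMr // mulrAC ler_pdivrMr // -sN expr2 -mulrA ler_pM2l // mulrC.
move/eqP: hbad; rewrite sum_nat_seq_eq0 => /allP /(_ p).
rewrite mem_index_iota prime_gt0 // ltnS pPN => /(_ isT).
rewrite pp implyTb addn_eq0 => /andP[/eqP h1 /eqP h2].
apply: le_trans (central_minus_shift_ge R delta eps Q _ N p k m pp N0 eps0 d1 Q0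
  _ h1 h2 (leq_trans kK (le_floor_exp_sqrt_log _ _ _ _ c0 mN))); last first.
  by apply: le_trans hX _; rewrite ler_pM2l.
rewrite mulr1 ler_pM2l ?divr_gt0 ?subr_gt0 // ler_pM2r ?invr_gt0 //.
by rewrite ler_ln ?posrE ?ltr0n // ler_nat.
Qed.

(** The number of primes costs [expR (cp * X)], which turns the Chernoff rate [rho / cp] into
    [rho / cp - cp]. In the second term [c + 2 * cp] collects [K], the factor [p] and the number of
    primes. *)
Lemma bad_count_sum_le (R : realType) (c cp lam eps t rho : R) Q N :
  let X := Num.sqrt (ln N%:R) in
  (0 < N)%N -> 0 < cp -> 0 < X -> Q%:R * ln Q%:R <= cp * X -> 2 <= X / cp ->
  0 < lam <= 1 -> 0 < rho -> (0 < Q)%N -> 1 <= 2 * eps * Q%:R ->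
  0 < eps <= 1 -> (1 + lam) / 2 + eps <= expR (t * ln lam - rho) ->
  (\sum_(0 <= m < N.+1) bad_count c cp t eps Q N m)%N%:R <=
  N%:R * (2 * Q%:R * expR (2 * rho) * expR (- ((rho / cp - cp) * X)) +
          2 * expR (- ((eps * X - (c + 2 * cp)) * X))).
Proof.
move=> X N0 cp0 X0 hQ X2 /andP[lam0 lam1] rho0 Q0 epsQ heps hrho.
have sN : X ^+ 2 = ln N%:R by rewrite sqr_sqrtr // ln_ge0 // ler1n.
set P := floor_exp_sqrt_log cp N; set K := floor_exp_sqrt_log c N.
have hP : P%:R <= expR (cp * X) := floor_exp_sqrt_log_le _ _ _.
have hK : K%:R <= expR (c * X) := floor_exp_sqrt_log_le _ _ _.
pose B := Q%:R * (2 * N%:R * expR (- rho * (X / cp - 2))) +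
  2 * N%:R * K%:R * P%:R * expR (- (eps * X ^+ 2)).
have B0 : 0 <= B by rewrite addr_ge0 // !mulr_ge0 // expR_ge0.
apply: (@le_trans _ _ (P%:R * B)).
  rewrite exchange_big /= natr_sum.
  apply: (@le_trans _ _ (\sum_(1 <= p < P.+1) B)); last first.
    by rewrite sumr_const_nat subn1 mulr_natl.
  rewrite big_nat_cond [leRHS]big_nat big_mkcondr /=.
  apply: ler_sum => p /andP[p1]; rewrite ltnS => pP.
  case: ifP => // pp; rewrite big_split natrD lerD //.
    apply: (few_carries_count_le R lam eps) => //.
    - exact: prime_le_floor_exp.
    - by case/andP: heps.
  apply: le_trans (long_run_count_le R eps X K N p pp N0 heps sN) _.
  by rewrite ler_wpM2r ?expR_ge0 // ler_wpM2l ?mulr_ge0 // ler_nat.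
apply: (@le_trans _ _ (expR (cp * X) *
    (Q%:R * (2 * N%:R * expR (- rho * (X / cp - 2))) +
     2 * N%:R * expR (c * X) * expR (cp * X) * expR (- (eps * X ^+ 2))))).
  apply: ler_pM => //; rewrite lerD2l ler_wpM2r ?expR_ge0 //.
  rewrite -!mulrA ler_wpM2l // ler_wpM2l // ler_pM //.
have -> : - ((rho / cp - cp) * X) = cp * X + (- rho * (X / cp - 2) - 2 * rho).
  by ring.
have -> : - ((eps * X - (c + 2 * cp)) * X) =
  cp * X + (c * X + (cp * X + - (eps * X ^+ 2))) by ring.
rewrite !expRD (expRN (2 * rho)); have e2 : expR (2 * rho) != 0 by rewrite gt_eqF ?expR_gt0.
rewrite le_eqVlt; apply/orP; left; apply/eqP; field; exact: e2.
Qed.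

(** * From rare exceptions to density 1 *)

Lemma density1_of_exceptions (R : realType) (A : set nat) :
  (forall e : R, 0 < e -> exists n0 m0 : nat, forall n, (n0 <= n)%N ->
    exists2 f : nat -> nat,
      forall m, (m0 <= m <= n)%N -> f m = 0%N -> A m &
      (\sum_(0 <= m < n.+1) f m)%N%:R <= e * n%:R) ->
  asymptotic_density A (1 : R).
Proof.
move=> h; apply/cvgrPdist_le => e e0.
have e2 : 0 < e / 2 by rewrite divr_gt0.
have [n0 [m0 hn]] := h _ e2.
pose n1 := (Num.truncn (m0%:R / (e / 2))).+1.
exists (n0 + n1)%N => // n /= n01.
have [f fA fe] := hn n (leq_trans (leq_addr _ _) n01).
have n0' : (0 < n)%N by rewrite (leq_trans _ n01) // addnS.
have nR : 0 < n%:R :> R by rewrite ltr0n.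
set S := \sum_(1 <= m < n.+1 | _) 1.
have mn : m0%:R <= e / 2 * n%:R.
  rewrite mulrC -ler_pdivrMr //; apply: le_trans (ltW (truncnS_gt _)) _.
  by rewrite ler_nat (leq_trans (leq_addl _ _) n01).
have Sn : S <= n%:R.
  rewrite /S big_mkcond /= [leRHS](_ : _ = \sum_(1 <= m < n.+1) 1).
    by apply: ler_sum => m _; case: ifP.
  by rewrite sumr_const_nat subn1.
(* Each [m] from 1 to [n] lies in [A], lies below [m0], or has [f m] at least 1. *)
have nS : n%:R <= S + m0%:R + (\sum_(0 <= m < n.+1) f m)%N%:R.
  have m0E : (\sum_(1 <= m < n.+1) (m < m0)%N <= m0)%N.
    apply: (@leq_trans (\sum_(0 <= m < m0 + n.+1) (m < m0)%N)).
      by rewrite [leqRHS](big_cat_nat (n := 1)) //= ?addnS //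
        [X in (_ <= _ + X)%N](big_cat_nat (n := n.+1)) //= ?addnS ?ltnS ?leq_addl //
        addnCA leq_addr.
    rewrite (big_cat_nat (n := m0)) //= ?leq_addr //.
    rewrite [X in (_ + X)%N]big_nat [X in (_ + X)%N]big1 ?addn0; last first.
      by move=> i /andP[mi _]; apply/eqP; rewrite eqb0 -leqNgt.
    apply: (@leq_trans (\sum_(0 <= m < m0) 1)).
      by apply: leq_sum => i _; apply: leq_b1.
    by rewrite sum_nat_const_nat subn0 muln1.
  apply: (@le_trans _ _ (S + (\sum_(1 <= m < n.+1) (m < m0)%N)%N%:R +
      (\sum_(1 <= m < n.+1) f m)%N%:R)); last first.
    apply: lerD; first by rewrite lerD2l ler_nat.
    by rewrite ler_nat [leqRHS]big_ltn // leq_addl.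
  rewrite /S big_mkcond !natr_sum -!big_split /=.
  rewrite [leLHS](_ : _ = \sum_(1 <= m < n.+1) 1); last first.
    by rewrite sumr_const_nat subn1.
  apply: ler_sum_nat => m /andP[m1 mn1].
  case: ifPn => mA; first by rewrite -addrA lerDl addr_ge0.
  case: ltnP => mm0 /=; first by rewrite add0r lerDl.
  rewrite !add0r ler1n lt0n; apply: contraNneq mA => fm0.
  by rewrite inE; apply: fA fm0; rewrite mm0 -ltnS.
have SE : S / n%:R * n%:R = S by rewrite divfK ?gt_eqF.
rewrite ler_norml; apply/andP; split.
  have : S / n%:R <= 1 by rewrite ler_pdivrMr // mul1r.
  lra.
rewrite lerBlDr addrC -lerBlDr ler_pdivlMr //; nra.
Qed.

Theorem theorem3 (R : realType) (c cp delta : R)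
    (hc : 0 < c) (hccp : c < cp) (hcp : cp < cstar R)
    (hdelta0 : 0 < delta) (hdelta1 : delta < 1)
    (hI : cp ^+ 2 < rateI delta) :
  asymptotic_density (good_set c cp delta) (1 : R).
Proof.
have cp0 : 0 < cp := lt_trans hc hccp.
have [lam [eps [rho [hlam heps hrho hexp]]]] :=
  exists_slack R cp delta hdelta0 hdelta1 hI.
have /andP[eps0 eps1] := heps.
have rho0 : 0 < rho := le_lt_trans (sqr_ge0 cp) hrho.
set t := (1 - delta) / 2 + 2 * eps in hexp.
pose Q := (Num.truncn (2 * eps)^-1).+1.
have epsQ : 1 <= 2 * eps * Q%:R.
  by rewrite -ler_pdivrMl ?mulr_gt0 // mulr1 ltW // truncnS_gt.
have a0 : 0 < rho / cp - cp by rewrite subr_gt0 ltr_pdivlMr // -expr2.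
have dc0 : 0 < cp - c by rewrite subr_gt0.
(* From this threshold on, [2 * expR (c * x) <= expR (cp * x)] with [x] the square root of [ln m],
   which yields [2 * K(m) <= P(m) + 1]. *)
have [m0 hm0] := sqrt_ln_ge R (ln 2 / (cp - c)).
apply: density1_of_exceptions => e e0.
have C0 : 0 < 2 * Q%:R * expR (2 * rho) by rewrite !mulr_gt0 ?expR_gt0.
(* Each of the two terms of [bad_count_sum_le] gets half of [e]; the second carries a factor 2,
   hence [e / 4] below. *)
have [Y1 hY1] := expRN_le R (e / 2 / (2 * Q%:R * expR (2 * rho)))
  (divr_gt0 (divr_gt0 e0 (ltr0Sn _ 1)) C0).
have [Y2 hY2] := expRN_le R (e / 4) (divr_gt0 e0 (ltr0Sn _ 3)).
have [n1 h1] := sqrt_ln_ge R 1.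
have [n2 h2] := sqrt_ln_ge R (Q%:R * ln Q%:R / cp).
have [n3 h3] := sqrt_ln_ge R (2 * cp).
have [n4 h4] := sqrt_ln_ge R (2 * Q%:R * t / eps * cp).
have [n5 h5] := sqrt_ln_ge R (Y1 / (rho / cp - cp)).
(* Makes [eps * X - (c + 2 * cp)] at least 1, so the second exponent is at least [X] in absolute
   value. *)
have [n6 h6] := sqrt_ln_ge R ((c + 2 * cp + 1) / eps).
have [n7 h7] := sqrt_ln_ge R Y2.
exists (1 + n1 + n2 + n3 + n4 + n5 + n6 + n7)%N, (1 + m0)%N => n hn.
have [N0 nn1 nn2 nn3] : [/\ 0 < n, n1 <= n, n2 <= n & n3 <= n]%N.
  by move: hn; clear=> hn; split; lia.
have [nn4 nn5 nn6 nn7] : [/\ n4 <= n, n5 <= n, n6 <= n & n7 <= n]%N.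
  by move: hn; clear=> hn; split; lia.
move: (h1 n nn1) (h2 n nn2) (h3 n nn3) (h4 n nn4) (h5 n nn5) (h6 n nn6) (h7 n nn7).
move=> {}h1 {}h2 {}h3 {}h4 {}h5 {}h6 {}h7.
set X := Num.sqrt (ln n%:R) in h1 h2 h3 h4 h5 h6 h7.
have X0 : 0 < X := lt_le_trans ltr01 h1.
exists (bad_count c cp t eps Q n).
  move=> m /andP[m0m mn].
  have mpos : (0 < m)%N := leq_trans (ltn0Sn _) m0m.
  have mm0 : (m0 <= m)%N := leq_trans (leq_addl 1 m0) m0m.
  apply: good_of_bad_count0 => //; first by rewrite mpos.
    by rewrite -/X -ler_pdivrMl // mulrC ler_pdivlMr.
  have {}hm0 := hm0 m mm0.
  rewrite ler_pdivrMr // in hm0.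
  rewrite -ltnS -(ltr_nat R) natrM.
  have h1K := floor_exp_sqrt_log_le R c m.
  have h1P : expR (cp * Num.sqrt (ln m%:R)) < (floor_exp_sqrt_log cp m).+1%:R.
    exact: truncnS_gt.
  have : 2 * expR (c * Num.sqrt (ln m%:R)) <= expR (cp * Num.sqrt (ln m%:R)) :> R.
    rewrite -{1}[2](lnK (x := 2 : R)) ?posrE // -expRD ler_expR; lra.
  have : (floor_exp_sqrt_log cp m).+1%:R < (floor_exp_sqrt_log cp m).+2%:R :> R.
    by rewrite ltr_nat.
  lra.
apply: le_trans (bad_count_sum_le R c cp lam eps t rho Q n _ _ _ _ _ _ _ _ _ _ _) _
  => //.
- by rewrite -/X [leRHS]mulrC -ler_pdivrMr.
- by rewrite -/X ler_pdivlMr.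
rewrite -/X mulrC ler_wpM2r //.
have E1 : 2 * Q%:R * expR (2 * rho) * expR (- ((rho / cp - cp) * X)) <= e / 2.
  by rewrite mulrC -ler_pdivlMr // hY1 // mulrC -ler_pdivrMr.
have E2 : expR (- ((eps * X - (c + 2 * cp)) * X)) <= e / 4.
  apply: hY2; apply: le_trans h7 _; rewrite ler_peMl ?(ltW X0) //.
  by move: h6; rewrite ler_pdivrMr //; lra.
lra.
Qed.
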